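(* Let $\mathcal{I}$ be an inference system over a set $\mathcal{S}$ of propositions, with a fixed well-founded strict order $\prec$ on $\mathcal{S}$, such that: $\mathcal{I}$ is finite in conclusions and has a complement $\mathcal{J}$; $\mathcal{I}$ is included in and equivalent to a saturated system $\mathcal{I}'$; and the system $\mathcal{A}$ consisting of the introduction rules of $\mathcal{I}'$ is finite in conclusions and has a complement $\mathcal{B}$. Then, for every proposition $A$, if the sequent $\not\vdash A$ has a proof in the system $\mathcal{A}_{\mathcal{B}}$, it has a (possibly infinite) proof in the system $\mathcal{I}_{\mathcal{J}}$.
   Context: An inference rule over $\mathcal{S}$ is a partial function $f:\mathcal{S}^n\rightharpoonup\mathcal{S}$ ($n\ge 0$ its number of premises); $B$ is derivable from $\langle A_1,\dots,A_n\rangle$ with $f$ if $f(A_1,\dots,A_n)$ is defined and equals $B$. An inference system is a set of rules; it is finite in conclusions if each proposition is derivable with a rule of the system from only finitely many sequences. A (possibly infinite) proof is a (possibly infinite) tree labeled with propositions (or sequents) where every node labeled $B$ with children labeled $A_1,\dots,A_n$ has $B$ derivable from $\langle A_1,\dots,A_n\rangle$ by a rule of the system. Two systems are equivalent if the same propositions have finite proofs in them. Complement: for $\mathcal{I}$ finite in conclusions, $\mathcal{J}$ is a complement of $\mathcal{I}$ if $\mathcal{J}$ is finite in conclusions and for every $B$, if $\langle A^1_1,\dots,A^1_{n_1}\rangle,\dots,\langle A^p_1,\dots,A^p_{n_p}\rangle$ are all sequences from which $B$ is derivable with a rule of $\mathcal{I}$, then the sequences from which $B$ is derivable with a rule of $\mathcal{J}$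 are exactly the $\langle A^1_{j_1},\dots,A^p_{j_p}\rangle$, $1\le j_i\le n_i$. The complementation $\mathcal{I}_{\mathcal{J}}$ is the system on sequents $\vdash A$, $\not\vdash A$ with, for each $f\in\mathcal{I}$, the rule $\vdash A_1,\dots,\vdash A_n \mapsto\ \vdash f(A_1,\dots,A_n)$, and for each $f\in\mathcal{J}$, the rule $\not\vdash A_1,\dots,\not\vdash A_n\mapsto\ \not\vdash f(A_1,\dots,A_n)$; $\mathcal{A}_{\mathcal{B}}$ is defined in the same way. Introduction rules: a rule $r$ is an introduction rule if whenever $B$ is derivable from $\langle A_1,\dots,A_n\rangle$ with $r$, $A_i\prec B$ for all $i$. For each non-introduction rule, its premises are classified as major or non-major, the major premises being its $m$ leftmost premises for some $m\ge1$. Derivable rule: if $g$ has $n$ premises and each $f_i$ ($1\le i\le n$) is either a rule with $m_i$ premises or the identity (with $m_i=1$), the composition of $g$ with $f_1,\dots,f_n$ is the rule $h(x^1_1,\dots,x^1_{m_1},\dots,x^n_1,\dots,x^n_{m_n})=g(f_1(x^1_1,\dots,x^1_{m_1}),\dots,f_n(x^n_1,\dots,x^n_{m_n}))$, defined exactly when all inner applications and the outer one are defined. Simplification: if a rule $f$ with domain $D$ has positions $i\neq j$ with $x_i=x_j$ for all tuples in $D$, it may be replaced by the rule $f'$ obtained by dropping the $j$-th argument (and using $x_i$ in its place); the simplification of a rule is the result of performing such replacements until none applies. Saturated system: a system is saturated if whenever it contains a non-introduction rule $g$ with $n$ premises whose $m$ leftmost premises are major, and $m$ introduction rules $f_1,\dots,f_m$,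 it also contains the simplification of the composition of $g$ with $f_1,\dots,f_m$ and $n-m$ times the identity function. *)

(* Defs.v *)
From Stdlib Require List RelationClasses Relation_Operators.
From mathcomp Require Import all_boot.

Set Implicit Arguments.
Unset Strict Implicit.
Unset Printing Implicit Defensive.

Record rule (S : Type) := Rule {
  arity : nat;
  app : arity.-tuple S -> option S
}.

(* [s] is a premise sequence of any length: undefined unless [size s = arity r]. *)
Definition eval S (r : rule S) (s : seq S) : option S :=
  obind (@app S r) (insub s).

Definition system (S : Type) := rule S -> Prop.

Definition derivable S (I : system S) (As : seq S) (B : S) : Prop :=
  exists2 r, I r & eval r As = Some B.

Definition finite_in_conclusions S (I : system S) : Prop :=
  forall B, exists L : seq (seq S),
    forall As, derivable I As B -> List.In As L.

Definition included S (I I' : system S) : Prop := forall r, I r -> I' r.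

(* Finitely branching, possibly infinitely deep. *)
CoInductive tree (T : Type) := Node (b : T) (n : nat) (children : 'I_n -> tree T).

Definition label T (t : tree T) : T := let: Node b _ _ := t in b.

(* A finitely branching tree is finite iff it is well-founded. *)
Inductive finite_tree T : tree T -> Prop :=
| FiniteNode b n (c : 'I_n -> tree T) :
    (forall i, finite_tree (c i)) -> finite_tree (Node b c).

CoInductive is_proof T (I : system T) : tree T -> Prop :=
| ProofNode b n (c : 'I_n -> tree T) :
    derivable I [tuple label (c i) | i < n] b ->
    (forall i, is_proof I (c i)) -> is_proof I (Node b c).

Definition has_proof T (I : system T) (A : T) : Prop :=
  exists2 t, label t = A & is_proof I t.

Definition has_finite_proof T (I : system T) (A : T) : Prop :=
  exists2 t, label t = A & is_proof I t /\ finite_tree t.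

Definition equivalent S (I I' : system S) : Prop :=
  forall A, has_finite_proof I A <-> has_finite_proof I' A.

(* The tuples of choices depend on the order in which the premise sequences
   are listed, so a repetition-free listing [L] is chosen for each [B]. *)
Definition is_complement S (I J : system S) : Prop :=
  finite_in_conclusions J /\
  forall B, exists L : seq (seq S),
    [/\ List.NoDup L,
        forall As, List.In As L <-> derivable I As B
      & forall Cs, derivable J Cs B <-> List.Forall2 (@List.In S) Cs L].

Record sequent (S : Type) := Sequent { positive : bool; prop : S }.

(* The sequents |- A and |/- A. *)
Definition asserts S (A : S) : sequent S := Sequent true A.
Definition denies S (A : S) : sequent S := Sequent false A.

Definition signed_rule S (b : bool) (f : rule S) : rule (sequent S) :=
  Rule (fun t : (arity f).-tuple (sequent S) =>
    if all (fun s => positive s == b) t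
    then omap (Sequent b) (app [tuple of map (@prop S) t]) else None).

Definition complementation S (I J : system S) : system (sequent S) :=
  fun r => (exists2 f, I f & r = signed_rule true f)
        \/ (exists2 f, J f & r = signed_rule false f).

Definition introduction S (prec : S -> S -> Prop) (r : rule S) : Prop :=
  forall As B, eval r As = Some B -> List.Forall (fun A => prec A B) As.

Definition introduction_rules S (prec : S -> S -> Prop) (I : system S) :
    system S :=
  fun r => I r /\ introduction prec r.

(* [major g] is the number of major premises of [g], which are its leftmost
   ones; it is meaningful only when [g] is not an introduction rule. *)
Definition major_classification S (prec : S -> S -> Prop)
    (major : rule S -> nat) : Prop :=
  forall g, ~ introduction prec g -> 1 <= major g <= arity g.

Definition id_rule S : rule S := Rule (fun t : 1.-tuple S => Some (thead t)).

Definition all_some T (s : seq (option T)) : option (seq T) :=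
  foldr (fun o acc => obind (fun x => omap (cons x) acc) o) (Some [::]) s.

(* Used with [size fs = arity g]; the argument is cut into consecutive blocks
   whose lengths are the arities of [fs]. *)
Definition compose S (g : rule S) (fs : seq (rule S)) : rule S :=
  let ms := map (@arity S) fs in
  Rule (fun x : (sumn ms).-tuple S =>
    obind (eval g)
      (all_some [seq eval p.1 p.2 | p <- zip fs (reshape ms x)])).

(* Inserts at position [j] a copy of the [i]-th entry of [y]; that entry then
   sits at position [lift j i], which ranges over the positions other than [j]. *)
Definition insert_copy S n (j : 'I_n.+1) (i : 'I_n) (y : n.-tuple S) :
    n.+1.-tuple S :=
  [tuple tnth y (odflt i (unlift j k)) | k < n.+1].

Inductive simplify1 S : rule S -> rule S -> Prop :=
| Simplify1 n (f : n.+1.-tuple S -> option S) (j : 'I_n.+1) (i : 'I_n) :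
    (forall x, f x <> None -> tnth x (lift j i) = tnth x j) ->
    simplify1 (Rule f) (Rule (fun y => f (insert_copy j i y))).

(* The result is unique only up to the order of the remaining arguments, since
   either of two equal arguments may be dropped; [saturated] accepts any one
   of the results. *)
Definition simplification S (f h : rule S) : Prop :=
  Relation_Operators.clos_refl_trans _ (@simplify1 S) f h /\
  forall h', ~ simplify1 h h'.

Definition saturated S (prec : S -> S -> Prop) (major : rule S -> nat)
    (I : system S) : Prop :=
  forall (g : rule S) (fs : seq (rule S)),
    I g -> ~ introduction prec g ->
    size fs = major g ->
    List.Forall (fun f => I f /\ introduction prec f) fs ->
    exists2 h,
      simplification
        (compose g (fs ++ nseq (arity g - major g) (id_rule S))) h
      & I h.

(* Main.v *)
(** Each rule instance of [I] deriving an unprovable proposition has an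
    unprovable premise, so the unprovable propositions are closed under a suitable
    choice of premises with [J]: this unfolds into a possibly infinite proof of
    [|/- A] as soon as [A] is unprovable in [I].
    A proof of [|/- A] in the complementation of the introduction rules excludes
    a finite proof of [A] with introduction rules only, and saturation permits
    the elimination of the other rules: composing a non-introduction rule with
    the last rules of the proofs of its major premises gives an instance of
    a rule of [I'] with the same conclusion, whose premises have proofs
    of smaller total size. *)

Require Import Defs.
From Stdlib Require RelationClasses.
From Stdlib Require Import ClassicalEpsilon.
From mathcomp Require Import all_boot.

Set Implicit Arguments.
Unset Strict Implicit.
Unset Printing Implicit Defensive.

Lemma Forall_tnth T (P : T -> Prop) n (t : n.-tuple T) :
  List.Forall P t <-> forall i, P (tnth t i).
Proof.
elim: n t => [|n IHn] t; first by rewrite (tuple0 t); split=> [_ []|].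
case/tupleP: t => x t; rewrite List.Forall_cons_iff IHn; split=> [[Px Pt] i|Pt].
  by case: (unliftP ord0 i) => [j|] ->; rewrite ?tnthS.
by split=> [|i]; [have := Pt ord0 | have := Pt (lift ord0 i); rewrite tnthS].
Qed.

Lemma evalP S (r : rule S) s B :
  eval r s = Some B <-> exists2 t : (arity r).-tuple S, tval t = s & app t = Some B.
Proof.
split=> [|[t <- tB]]; last by rewrite /eval valK.
by rewrite /eval; case: insubP => //= t _ <- tB; exists t.
Qed.

Lemma eval_size S (r : rule S) s B : eval r s = Some B -> size s = arity r.
Proof. by case/evalP=> t <- _; apply: size_tuple. Qed.

(** * Possibly infinite proofs, finite proofs and their sizes *)

Section Proofs.

Variables (T : Type) (I : system T).

Lemma is_proof_coind (X : tree T -> Prop) :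
  (forall t, X t -> let: Node b n c := t in
     derivable I [tuple label (c i) | i < n] b /\ forall i, X (c i)) ->
  forall t, X t -> is_proof I t.
Proof.
move=> stepX; cofix H; case=> b n c /stepX[dB Xc].
by apply: ProofNode => // i; apply: H.
Qed.

(** Choice turns the closure of [X] into a function, from which a tree of possibly infinite depth is
    unfolded corecursively. *)
Lemma has_proof_coind (X : T -> Prop) :
  (forall b, X b -> exists2 s, derivable I s b & List.Forall X s) ->
  forall b, X b -> has_proof I b.
Proof.
move=> stepX.
have step b : {s : seq T | X b -> derivable I s b /\ List.Forall X s}.
  apply: constructive_indefinite_description.
  case: (classic (X b)) => [/stepX[s ? ?]|nX]; first by exists s.
  (* The unfolding from a member of [X] never leaves [X], so any default serves here. *)
  by exists [::].
pose unroll := cofix unroll b : tree T :=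
  Node b (fun i => unroll (tnth (in_tuple (sval (step b))) i)).
move=> b Xb; exists (unroll b) => //.
apply: (@is_proof_coind (fun t => exists2 b, X b & t = unroll b)); last by exists b.
move=> _ [{Xb}b Xb ->] /=; have [ds Xs] := svalP (step b) Xb; split.
  by rewrite (map_tnth_enum (in_tuple _)).
move=> i; exists (tnth (in_tuple (sval (step b))) i) => //.
by move: i; apply/Forall_tnth.
Qed.

Lemma has_proof_inv b :
  has_proof I b -> exists2 s, derivable I s b & List.Forall (has_proof I) s.
Proof.
case=> t <- pt; case: pt => {}b n c db pc.
exists [tuple label (c i) | i < n] => //.
by apply/Forall_tnth => i; rewrite tnth_mktuple; exists (c i).
Qed.

Lemma finite_proof_intro s b :
  derivable I s b -> List.Forall (has_finite_proof I) s -> has_finite_proof I b.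
Proof.
rewrite -[s]/(tval (in_tuple s)) => ds /Forall_tnth/fin_all_exists2[c lc pc].
exists (Node b c) => //; split; constructor; try by move=> i; case: (pc i).
suff -> : [tuple label (c i) | i < size s] = in_tuple s by [].
by apply: eq_from_tnth => i; rewrite tnth_mktuple lc.
Qed.

Lemma finite_proof_ind (P : T -> Prop) :
  (forall s b, derivable I s b -> List.Forall P s -> P b) ->
  forall b, has_finite_proof I b -> P b.
Proof.
move=> stepP _ [t <- [pt ft]]; elim: ft pt => b n c _ IHc pt.
(* A dependent match inverts [is_proof]: the type of [c] depends on [n], so plain inversion would
   leave an equality of dependent pairs. *)
have [db pc] : derivable I [tuple label (c i) | i < n] b
             /\ forall i, is_proof I (c i).
  exact: (match pt in is_proof _ t return
    let: Node b n c := t in derivable I [tuple label (c i) | i < n] b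
      /\ forall i, is_proof I (c i) with ProofNode _ _ _ db pc => conj db pc end).
by apply: stepP db _; apply/Forall_tnth => i; rewrite tnth_mktuple; apply: IHc.
Qed.

(* [n] is the total number of nodes of some finite proofs of the members of [s]. *)
Inductive provable_seq : seq T -> nat -> Prop :=
| ProvableNil : provable_seq [::] 0
| ProvableCons b r s m n : derivable I r b -> provable_seq r m ->
    provable_seq s n -> provable_seq (b :: s) (m + n).+1.

Lemma provable_cat s1 s2 n1 n2 :
  provable_seq s1 n1 -> provable_seq s2 n2 -> provable_seq (s1 ++ s2) (n1 + n2).
Proof.
move=> p1 p2; elim: p1 => // b r s m n dr pr _ _ IHs.
by rewrite addSn -addnA; apply: ProvableCons dr pr IHs.
Qed.

Lemma provable_catE s1 s2 n : provable_seq (s1 ++ s2) n ->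
  exists n1 n2, [/\ provable_seq s1 n1, provable_seq s2 n2 & n = n1 + n2].
Proof.
elim: s1 n => [|b s1 IHs] n /= p.
  by exists 0, n; split=> //; apply: ProvableNil.
move def_s: (b :: _) p => s p; case: p def_s => // b' r s' m n' dr pr ps' [eq_b].
move: dr ps'; rewrite -eq_b => dr + def_s.
rewrite -def_s => /IHs[n1 [n2 [p1 p2 ->]]].
exists (m + n1).+1, n2; split; rewrite ?addSn ?addnA //.
exact: ProvableCons dr pr p1.
Qed.

Lemma Forall_provable s :
  List.Forall (fun b => exists n, provable_seq [:: b] n) s ->
  exists n, provable_seq s n.
Proof.
elim=> [|b {}s [m pb] _ [n ps]]; first by exists 0; apply: ProvableNil.
by exists (m + n); rewrite -cat1s; apply: provable_cat.
Qed.

Lemma provable_seqP s :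
  (exists n, provable_seq s n) <-> List.Forall (has_finite_proof I) s.
Proof.
split=> [[n p]|ps].
  elim: p => [|b r {}s m {}n dr _ IHr _ IHs]; first by constructor.
  by constructor=> //; apply: finite_proof_intro dr IHr.
apply: Forall_provable; apply: List.Forall_impl ps => b.
elim/finite_proof_ind=> {}s {}b ds /Forall_provable[n ps].
by exists (n + 0).+1; apply: ProvableCons ds ps ProvableNil.
Qed.

End Proofs.

(** * Rules under signing, simplification and composition *)

Section Rules.

Variable S : Type.
Implicit Types (f g h r : rule S) (I : system S) (s : seq S).

(** A signed rule gives its sign to its conclusion and demands it of its premises, so the denied
    half of a complementation is a copy of [J]. *)
Lemma derivable_denies I J ss A :
  derivable (complementation I J) ss (denies A) <->
  exists2 s, ss = [seq denies B | B <- s] & derivable J s A.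
Proof.
split=> [[_ [[f _ ->]|[f Jf ->]]]|[s -> [f Jf /evalP[t <- tA]]]].
- by case/evalP=> t _ /=; case: ifP => // _; case: (app _).
- case/evalP=> t <- /=; case: ifP => // neg_t.
  case def_B: (app _) => [B|//] [eq_BA]; rewrite -eq_BA.
  exists [seq prop C | C <- t]; last first.
    by exists f => //; apply/evalP; exists [tuple of map (@prop S) t].
  rewrite -map_comp -[LHS]map_id; elim: (tval t) neg_t => //= -[b C] u IHu.
  by case/andP=> /eqP/= -> /IHu ->.
exists (signed_rule false f); first by right; exists f.
apply/evalP; exists [tuple of map (@denies S) t] => //=.
rewrite all_map (@eq_all _ _ predT) // all_predT.
suff -> : [tuple of map (@prop S) [tuple of map (@denies S) t]] = t by rewrite tA.
by apply: eq_from_tnth => i; rewrite !tnth_map.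
Qed.

Lemma tuple_lift n (x : n.+1.-tuple S) (j : 'I_n.+1) :
  [tuple tnth x (lift j k) | k < n] = take j x ++ drop j.+1 x :> seq S.
Proof.
have lt_jx : j < size x by rewrite size_tuple.
apply: (@eq_from_nth _ (tnth x j)) => [|k].
  rewrite size_cat size_takel ?(ltnW lt_jx) // size_drop !size_tuple.
  by rewrite subSS subnKC // -ltnS.
rewrite size_tuple => lt_kn.
rewrite -(tnth_nth _ _ (Ordinal lt_kn)) tnth_mktuple (tnth_nth (tnth x j)) /=.
rewrite nth_cat size_takel ?(ltnW lt_jx) // /bump.
case: ltnP => [lt_kj|le_jk]; first by rewrite nth_take.
by rewrite nth_drop addSn subnKC.
Qed.

Lemma insert_copyK n (x : n.+1.-tuple S) (j : 'I_n.+1) (i : 'I_n) :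
  tnth x (lift j i) = tnth x j ->
  insert_copy j i [tuple tnth x (lift j k) | k < n] = x.
Proof.
move=> eq_x; apply: eq_from_tnth => k; rewrite !tnth_mktuple.
by case: unliftP => [l|] ->.
Qed.

(** Dropping a repeated premise discards one proof of it, so the total size cannot grow. *)
Lemma provable_simplification I f h s B n :
  simplification f h -> eval f s = Some B -> provable_seq I s n ->
  exists s' n', [/\ eval h s' = Some B, provable_seq I s' n' & n' <= n].
Proof.
case=> fh _.
elim: fh s n => {f h} [_ _ [m f j i eq_f]|f|f g h _ IHfg _ IHgh] s n.
- case/evalP=> /= x <- fx px; pose y := [tuple tnth x (lift j k) | k < m].
  have def_x : x = take j x ++ [:: tnth x j] ++ drop j.+1 x :> seq S.
    by rewrite (tnth_nth (tnth x j)) cat1s -drop_nth ?size_tuple // cat_take_drop.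
  move: px; rewrite def_x => /provable_catE[n1 [k [p1 + ->]]].
  case/provable_catE=> n2 [n3 [_ p3 ->]].
  exists y, (n1 + n3); split.
  + apply/evalP; exists y => //=; rewrite insert_copyK //.
    by apply: eq_f; rewrite fx.
  + by rewrite tuple_lift; apply: provable_cat.
  by rewrite leq_add2l leq_addl.
- by exists s, n.
move=> fs /(IHfg _ _ fs)[s' [n' [gs' ps' le_n']]].
have [s2 [n2 [hs2 ps2 le_n2]]] := IHgh _ _ gs' ps'.
by exists s2, n2; split=> //; apply: leq_trans le_n'.
Qed.

(** Removing the root of each proof leaves proofs of its premises and saves exactly one node per
    member of [s]. *)
Lemma provable_last_rules I s n : provable_seq I s n ->
  exists fs Xs n', [/\ List.Forall I fs, size fs = size Xs,
    [seq eval p.1 p.2 | p <- zip fs Xs] = map Some s,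
    provable_seq I (flatten Xs) n' & n = n' + size s].
Proof.
elim=> [|b r {}s m {}n [f If fr] pr _ _ [fs [Xs [n' [Ifs sz_fs ev_fs pX ->]]]]].
  by exists [::], [::], 0; split=> //; apply: ProvableNil.
exists (f :: fs), (r :: Xs), (m + n'); split=> /=; rewrite ?sz_fs ?fr ?ev_fs //.
- by constructor.
- exact: provable_cat.
by rewrite addnA addnS.
Qed.

Lemma eval_compose g fs Xs s :
  size fs = size Xs -> [seq eval p.1 p.2 | p <- zip fs Xs] = map Some s ->
  eval (compose g fs) (flatten Xs) = eval g s.
Proof.
move=> sz_fs ev_fs.
(* The arity check in [eval] fixes the block lengths, so [reshape] recovers [Xs]. *)
have shapeX : shape Xs = map (@arity S) fs.
  elim: fs Xs s sz_fs ev_fs => [|f fs IHfs] [|X Xs] [|B s] //=.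
  move=> [sz_fs] [fX ev_fs].
  by rewrite (eval_size fX) (IHfs _ _ sz_fs ev_fs).
have sz_X : size (flatten Xs) == sumn (map (@arity S) fs).
  by rewrite size_flatten shapeX.
rewrite {1}/eval (insubT (fun X => size X == _) sz_X) /= -shapeX flattenK ev_fs.
suff -> : all_some (map Some s) = Some s by [].
by elim: (s) => //= B r ->.
Qed.

End Rules.

(** * Elimination of the non-introduction rules *)

Section Elimination.

Variables (S : Type) (prec : S -> S -> Prop) (major : rule S -> nat).
Variable I' : system S.
Hypothesis major_ok : major_classification prec major.
Hypothesis satI' : saturated prec major I'.

Let intro_I' := introduction_rules prec I'.

(** Strong induction on [n]. The rule obtained by saturation need not be an introduction rule, so
    the induction ranges over all rules of [I']. *)
Lemma eliminate_rule n s B :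
  derivable I' s B -> provable_seq intro_I' s n -> has_finite_proof intro_I' B.
Proof.
elim/ltn_ind: n s => n IHn s [g I'g gs] ps.
case: (classic (introduction prec g)) => [intro_g|nintro_g].
  apply: (@finite_proof_intro _ _ s); first by exists g.
  by apply/provable_seqP; exists n.
have /andP[major_gt0 le_major] := major_ok nintro_g.
have sz_s := eval_size gs; set m := major g in major_gt0 le_major *.
have sz_major : size (take m s) = m by rewrite size_takel ?sz_s.
move: ps; rewrite -{1}(cat_take_drop m s) => /provable_catE[k [n2 [+ p2 def_n]]].
case/provable_last_rules=> fs [Xs [n1 [intro_fs sz_fs ev_fs p1 def_n1]]].
have sz_fsm : size fs = m.
  by have /(congr1 size) := ev_fs; rewrite !size_map size_zip -sz_fs minnn sz_major.
have [h simp_h I'h] := satI' I'g nintro_g sz_fsm intro_fs.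
(* The identity rules keep the non-major premises, as blocks of length one. *)
set ids := nseq _ _ in simp_h; pose Ys := [seq [:: A] | A <- drop m s].
have sz_ids : size ids = size Ys by rewrite size_nseq size_map size_drop sz_s.
have ev_ids : [seq eval p.1 p.2 | p <- zip ids Ys] = map Some (drop m s).
  rewrite /ids /Ys -sz_s -size_drop; elim: (drop m s) => //= A r ->.
  by congr (_ :: _); apply/evalP; exists [tuple A].
have hXY : eval (compose g (fs ++ ids)) (flatten (Xs ++ Ys)) = Some B.
  rewrite (@eval_compose _ _ _ _ s) ?size_cat ?sz_fs ?sz_ids // zip_cat // map_cat.
  by rewrite ev_fs ev_ids -map_cat cat_take_drop.
have pXY : provable_seq intro_I' (flatten (Xs ++ Ys)) (n1 + n2).
  by rewrite flatten_cat /Ys flatten_map1 map_id; apply: provable_cat.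
have [s' [n' [hs' ps' le_n']]] := provable_simplification simp_h hXY pXY.
apply: IHn ps'; last by exists h.
(* The roots of the [m] major premises are gone and [m] is at least 1, hence the strict decrease. *)
apply: leq_ltn_trans le_n' _.
by rewrite def_n def_n1 sz_major -addnA ltn_add2l addnC -addn1 leq_add2l.
Qed.

(** Premises are treated before conclusions, so [eliminate_rule] only meets premises already proved
    with introduction rules. *)
Lemma introduction_complete A :
  has_finite_proof I' A -> has_finite_proof intro_I' A.
Proof.
elim/finite_proof_ind=> s B ds /provable_seqP[n ps].
exact: eliminate_rule ds ps.
Qed.

End Elimination.

(** * From denials to unprovability and back *)

Lemma denial_unprovable S (I J : system S) A :
  is_complement I J -> has_proof (complementation I J) (denies A) ->
  ~ has_finite_proof I A.
Proof.
case=> _ complJ + pA; elim/finite_proof_ind: pA => s {}A ds IHs.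
case/(@has_proof_inv _ _ _)=> ss /derivable_denies[Cs -> dCs] /List.Forall_map pCs.
have [L [_ /(_ s)[_ /(_ ds) sL] /(_ Cs)[/(_ dCs) CsL _]]] := complJ A.
(* The last step of the finite proof uses a sequence [s] of [L], and [Cs] picks a member of each:
   its pick in [s] has a provable denial, which the induction hypothesis forbids. *)
have [C pC Cs_] :
    exists2 C, has_proof (complementation I J) (denies C) & List.In C s.
  elim: CsL pCs sL {dCs} => //= C r {}Cs {}L rC _ IHL /List.Forall_cons_iff[pC pCs].
  by case=> [<-|]; [exists C | apply: IHL].
by have /List.Forall_forall/(_ C Cs_) := IHs; apply.
Qed.

Theorem theorem3 (S : Type) (prec : S -> S -> Prop) (major : rule S -> nat)
    (I J I' B : system S) :
  RelationClasses.StrictOrder prec ->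
  well_founded prec ->
  major_classification prec major ->
  finite_in_conclusions I ->
  is_complement I J ->
  included I I' ->
  equivalent I I' ->
  saturated prec major I' ->
  finite_in_conclusions (introduction_rules prec I') ->
  is_complement (introduction_rules prec I') B ->
  forall A : S,
    has_proof (complementation (introduction_rules prec I') B) (denies A) ->
    has_proof (complementation I J) (denies A).
Proof.
move=> _ _ major_ok _ [_ complJ] _ eqI satI' _ complB A pA.
have nA : ~ has_finite_proof I A.
  move=> /eqI/(introduction_complete major_ok satI').
  by apply: denial_unprovable pA.
(* The invariant keeps only unprovability in [I]; the given proof of the denial is no longer
   followed. *)
pose X ss := exists2 C, ss = denies C & ~ has_finite_proof I C.
apply: (@has_proof_coind _ _ X); last by exists A.
move=> _ [{pA nA}A -> nA]; have [L [_ defL defJ]] := complJ A.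
have [Cs CsL nCs] : exists2 Cs, List.Forall2 (@List.In S) Cs L
                 & List.Forall (fun C => ~ has_finite_proof I C) Cs.
  have : forall s, List.In s L -> derivable I s A by move=> s /defL.
  elim: L {defL defJ} => [|s L IHL] dL; first by exists [::]; constructor.
  have [|Cs CsL nCs] := IHL; first by move=> r rL; apply: dL; right.
  have [C [Cs_ nC]] : exists C, List.In C s /\ ~ has_finite_proof I C.
    (* If all members of [s] were provable, [s] would yield a proof of [A]; classically, some member
       is thus unprovable. *)
    apply: NNPP => nex; apply: nA; apply: finite_proof_intro (dL s _) _.
      by left.
    by apply/List.Forall_forall => C Cs_; apply: NNPP => nC; apply: nex; exists C.
  by exists (C :: Cs); constructor.
exists [seq denies C | C <- Cs].
  by apply/derivable_denies; exists Cs => //; apply/defJ.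
by apply/List.Forall_map; apply: List.Forall_impl nCs => C nC; exists C.
Qed.
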